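(* For each $n$ let $\boldsymbol d=\boldsymbol d^{(n)}=(d_1,\dots,d_n)$ be a degree sequence with even sum $\ell=\ell(n)=\sum_{i=1}^n d_i$, let $n_j$ be the number of indices $i$ with $d_i=j$, and let $\ell_{\neq 2}=\sum_{j\neq 2} j n_j$. Assume that $n_0=0$ and $\ell_{\neq 2}=n_1$ for every $n$ (so all degrees are $1$ or $2$) and that, as $n\to\infty$, $\ell/n\to 2$ and $n_1\to\infty$. Let $\mathscr{C}_j$ denote the $j$-th largest connected component of the configuration model $\mathrm{CM}_n(\boldsymbol d)$ and $|\mathscr{C}_j|$ its number of vertices. Then, as $n\to\infty$, for every fixed $j\in\mathbb N$ with $j\ge 1$, $$|\mathscr{C}_j|=\frac{2n\log n_1}{n_1}\,(1+o_{\mathbb P}(1)).$$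
   Context: Configuration model: given a degree sequence $\boldsymbol d=(d_1,\dots,d_n)$ with even sum $\ell$, the random multigraph $\mathrm{CM}_n(\boldsymbol d)$ on vertices $v_1,\dots,v_n$ is obtained by attaching $d_i$ half-edges to $v_i$ for each $i$ and pairing all $\ell$ half-edges by a uniformly random perfect matching; each matched pair of half-edges forms an edge (self-loops and multiple edges are allowed). $o_{\mathbb P}(1)$ denotes a sequence of random variables converging to $0$ in probability. Ties in size between components are broken arbitrarily. *)

(* Defs.v *)
From HB Require Import structures.
From mathcomp Require Import all_boot all_order all_algebra.
From mathcomp Require Import all_classical all_reals all_analysis.

Set Implicit Arguments.
Unset Strict Implicit.
Unset Printing Implicit Defensive.

Import Order.TTheory GRing.Theory Num.Theory.
Import numFieldNormedType.Exports.

Local Open Scope ring_scope.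

Section ConfigurationModel.
Variables (n : nat) (d : 'I_n -> nat).

Definition total_degree : nat := (\sum_(i < n) d i)%N.

Definition num_deg (j : nat) : nat := #|[pred i | d i == j]|.

(* The sum over all j <> 2 is cut at the maximal degree: num_deg vanishes
   beyond it. *)
Definition total_degree_neq2 : nat :=
  (\sum_(j < (\max_(i < n) d i).+1 | j != 2 :> nat) j * num_deg j)%N.

(* [Tagged _ k], with [k : 'I_(d i)] and tag [i], is the k-th half-edge
   attached to the vertex i. *)
Definition half_edge := {i : 'I_n & 'I_(d i)}.

Definition is_perfect_matching (M : {set {set half_edge}}) : bool :=
  finset.partition M [set: half_edge]%SET && [forall e in M, #|e| == 2%N].

Definition perfect_matching := {M : {set {set half_edge}} | is_perfect_matching M}.

(* The multigraph of a matching M has the pairs in M as edges; loops and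
   multiplicities are irrelevant to its connected components, so only the
   adjacency relation on vertices is recorded. *)
Definition adjacent (M : perfect_matching) : rel 'I_n := fun v w =>
  [exists h, exists h', [&& [set h; h']%SET \in val M, tag h == v & tag h' == w]].

Definition components (M : perfect_matching) : {set {set 'I_n}} :=
  equivalence_partition (connect (adjacent M)) [set: 'I_n]%SET.

Definition component_sizes (M : perfect_matching) : seq nat :=
  sort geq [seq #|pred_of_set C| | C <- enum (components M)].

(* Indexing starts at j = 1; the value is 0 if there are fewer than j
   components. *)
Definition largest_component_size (j : nat) (M : perfect_matching) : nat :=
  nth 0%N (component_sizes M) j.-1.

End ConfigurationModel.

Definition uniform_prob_of (R : realType) (T : finType) (E : pred T) : R :=
  #|E|%:R / #|T|%:R.

(* X n is a random variable on the finite set T n with the uniform law; the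
   spaces T n need not be related to each other. *)
Definition little_o_P1 (R : realType) (T : nat -> finType)
    (X : forall n, T n -> R) : Prop :=
  forall eps : R, 0 < eps ->
    ((fun n => uniform_prob_of R [pred w : T n | (eps < `|X n w|)%R]) @ \oo
       --> (0 : R))%classic.

(* Main.v *)
Require Import Defs.
From HB Require Import structures.
From mathcomp Require Import all_boot all_order all_fingroup all_algebra.
From mathcomp Require Import all_classical all_reals all_analysis.
Import Order.TTheory GRing.Theory Num.Theory.
From mathcomp Require Import zify ring lra.
Import numFieldNormedType.Exports.
(* Let a walk leave a vertex through a half-edge, cross the matched pair, and go on
   through the other half-edge of the vertex it enters, as long as that vertex has
   degree 2 and is new. Revealing the matching along the walk, the probability to
   survive K steps is the product p_K of (2 n_2 - 2 i) / (l - 2 i - 1) over i < K,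
   which is about exp (- K n_1 / (2 n)).

   A component with at least K + 2 vertices either contains a vertex of degree 1,
   whose walk survives K steps, or is a cycle, all of whose half-edges have surviving
   walks; by Markov's inequality this has probability at most
   n_1 p_K + 2 n_2 p_K / (K + 2), which tends to 0 for K = (1 + eps) 2 n log n_1 / n_1.

   Conversely, let Z be the number of degree-1 vertices whose walk survives K steps.
   A component has at most two such vertices, and joint survival of two walks that do
   not meet has probability at most p_K^2, so Var Z <= 2 E Z = 2 n_1 p_K. For
   K = (1 - eps) 2 n log n_1 / n_1 this mean tends to infinity, and Chebyshev's
   inequality gives at least 2 j such vertices, hence j components with more than K
   vertices. *)

Set Implicit Arguments.
Unset Strict Implicit.
Unset Printing Implicit Defensive.

(** * Matchings as fixed-point-free involutions *)

Section MatchingCount.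
Variable H : finType.
Implicit Types (g : {ffun H -> H}) (c : seq (H * H)) (P : pred {ffun H -> H}).

Definition matching g := [forall x, (g (g x) == x) && (g x != x)].

Lemma matchingK g : matching g -> involutive g.
Proof. by move=> /forallP gm x; case/andP: (gm x) => /eqP. Qed.

Lemma matching_neq g x : matching g -> g x != x.
Proof. by move=> /forallP /(_ x) /andP[]. Qed.

Definition extends c g := all (fun p => g p.1 == p.2) c.

Definition supp c := unzip1 c ++ unzip2 c.

(** With [c] the list of pairs revealed so far, [num_ext c P / num_ext c predT] is the conditional
    probability of [P]. Statements are cross-multiplied to stay in [nat]. *)
Definition num_ext c P := #|[pred g | [&& matching g, extends c g & P g]]|.

Lemma mem_supp_partner c g x :
  matching g -> extends c g -> (g x \in supp c) = (x \in supp c).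
Proof.
move=> gm /allP gc.
have half y : y \in supp c -> g y \in supp c.
  rewrite /supp !mem_cat => /orP[] /mapP[p pc ->]; have /eqP gp := gc _ pc.
    by rewrite gp map_f ?orbT.
  by rewrite -gp (matchingK gm) map_f.
by apply/idP/idP => [/half|/half //]; rewrite (matchingK gm).
Qed.

Lemma num_ext_split c P x : x \notin supp c ->
  num_ext c P = (\sum_(y | y \notin x :: supp c) num_ext ((x, y) :: c) P)%N.
Proof.
move=> xc; rewrite /num_ext -sum1_card.
rewrite (partition_big (fun g => g x) (fun y => y \notin x :: supp c)) /=.
  apply: eq_bigr => y _; rewrite sum1_card; apply: eq_card => g.
  rewrite inE unfold_in inE /=; case: (matching g); case: (extends c g); case: (P g);
    by case: (g x == y).
move=> g; rewrite inE => /and3P[gm gc _].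
by rewrite inE negb_or (matching_neq x gm) mem_supp_partner.
Qed.

(* Conjugation by the transposition of [y] and [y'] shows that the partner of [x] is
   uniform among the half-edges that are still unmatched. *)
Lemma leq_num_ext_swap c x y y' :
  x \notin supp c -> y \notin x :: supp c -> y' \notin x :: supp c ->
  (num_ext ((x, y) :: c) predT <= num_ext ((x, y') :: c) predT)%N.
Proof.
rewrite !inE !negb_or => xc /andP[yx yc] /andP[y'x y'c].
pose t := tperm y y'.
have tid z : z \in supp c -> t z = z.
  by move=> zc; rewrite tpermD //; [apply: contraNneq yc => ->|apply: contraNneq y'c => ->].
pose F g : {ffun H -> H} := [ffun z => t (g (t z))].
have FK : involutive F by move=> g; apply/ffunP => z; rewrite !ffunE !tpermK.
rewrite /num_ext -(card_imset _ (inv_inj FK)); apply: subset_leq_card.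
apply/fintype.subsetP => _ /imsetP[g + ->]; rewrite !inE !andbT /= => /and3P[gm /eqP gx gc].
apply/and3P; split.
- apply/forallP => z; rewrite !ffunE tpermK (matchingK gm) tpermK eqxx /=.
  by rewrite -(inj_eq (@perm_inj _ t)) tpermK matching_neq.
- by rewrite ffunE (tpermD yx y'x) gx tpermL.
apply/allP => p pc; have p1 : p.1 \in supp c by rewrite mem_cat map_f.
have p2 : p.2 \in supp c by rewrite mem_cat [p.2 \in unzip2 c]map_f ?orbT.
have /eqP gp := allP gc _ pc; by rewrite ffunE (tid p.1) // gp tid.
Qed.

(** [leq_num_ext_swap], used in both directions, makes all admissible partners of [x] equally
    likely. *)
Lemma num_ext_step c x y :
  uniq (supp c) -> x \notin supp c -> y \notin x :: supp c ->
  (num_ext c predT = (#|H| - (size c).*2 - 1) * num_ext ((x, y) :: c) predT)%N.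
Proof.
move=> uc xc yc; rewrite (num_ext_split _ xc).
rewrite (eq_bigr (fun=> num_ext ((x, y) :: c) predT)); last first.
  by move=> z zc; apply/eqP; rewrite eqn_leq !leq_num_ext_swap.
rewrite sum_nat_const; congr (_ * _)%N.
have sz : #|x :: supp c| = (size c).*2.+1.
  by rewrite (card_uniqP _) /= ?xc // size_cat !size_map addnn.
rewrite -subnDA addn1 -sz -(cardC (mem (x :: supp c))) addKn.
by apply: eq_card => z; rewrite !inE.
Qed.

End MatchingCount.

(* [a (a - 2) (a - 4) ...] with [n] factors; truncated subtraction makes it vanish
   for even [a < 2 * n]. *)
Definition falling2 a n := (\prod_(i < n) (a - i.*2))%N.

Lemma falling2S a n : falling2 a n.+1 = (a * falling2 (a - 2) n)%N.
Proof.
rewrite /falling2 big_ord_recl subn0; congr (_ * _)%N.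
by apply: eq_bigr => i _; rewrite lift0 doubleS -subnDA.
Qed.

Lemma falling2_gt0 a k : (k.*2 <= a.+1)%N -> (0 < falling2 a k)%N.
Proof.
by move=> ka; rewrite prodn_gt0 // => i; rewrite subn_gt0; have := ltn_ord i; lia.
Qed.

Lemma falling2D a k l : falling2 a (k + l) = (falling2 a k * falling2 (a - k.*2) l)%N.
Proof.
rewrite /falling2 big_split_ord /=; congr (_ * _)%N; apply: eq_bigr => i _.
by rewrite doubleD subnDA.
Qed.

(** Factor by factor: [(a - x) / (b - x)] with [a <= b] decreases when [l] is subtracted from both
    terms. This yields the negative dependence of two walks. *)
Lemma falling2_ratio a b k l : (a <= b)%N ->
  (falling2 (a - l) k * falling2 b k <= falling2 a k * falling2 (b - l) k)%N.
Proof.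
move=> ab; rewrite /falling2 -!big_split /=; apply: leq_prod => i _; set x := i.*2.
have [la|la] := leqP (a - l) x; first by rewrite (_ : a - l - x = 0)%N ?mul0n //; lia.
have -> : (a = (a - l - x) + l + x)%N by lia.
have -> : (b = (b - a) + ((a - l - x) + l + x))%N by lia.
move: (a - l - x)%N (b - a)%N => u v.
rewrite (_ : u + l + x - l - x = u)%N; last by lia.
rewrite (_ : v + (u + l + x) - x = v + u + l)%N; last by lia.
rewrite (_ : u + l + x - x = u + l)%N; last by lia.
rewrite (_ : v + (u + l + x) - l - x = v + u)%N; last by lia.
nia.
Qed.

(** * Exact survival probabilities of walks *)

Section WalkCount.
Variables (H : finType) (s : H -> H).
Implicit Types (g : {ffun H -> H}) (A : {set H}).

(* The walk leaves the current vertex through the half-edge [x], enters the next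
   one at [g x], which must still be available, and leaves it through [s (g x)];
   after [k] steps, [P] is tested on the half-edges that remain available. *)
Fixpoint walk (P : {set H} -> pred {ffun H -> H}) k x A g : bool :=
  if k is k'.+1 then
    (g x \in A) && walk P k' (s (g x)) (A :\: [set g x; s (g x)]%SET) g
  else P A g.

(** Chaining through the continuation [P] lets each walk use only what its predecessors left
    available, so joint survival forces disjoint trajectories. *)
Definition walks K (xs : seq H) := foldr (fun x P => walk P K x) (fun=> predT) xs.

(** The partner of [x] is uniform among the unmatched half-edges, [#|A|] of which let the walk go
    on; entering at [y] uses up the two elements [y] and [s y] of [A]. *)
Lemma num_ext_walk_step P n c x A k :
  involutive s -> uniq (x :: supp c) -> 
  (forall y, y \in A -> [&& s y \in A, s y != y & y \notin x :: supp c]) ->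
  (forall y, y \in A -> 
    num_ext ((x, y) :: c) (walk P k (s y) (A :\: [set y; s y]%SET))
     * falling2 (#|H| - (size c).*2 - 3) n =
   falling2 (#|A| - 2) n * num_ext ((x, y) :: c) predT)%N ->
  (num_ext c (walk P k.+1 x A) * falling2 (#|H| - (size c).*2 - 1) n.+1 =
   falling2 #|A| n.+1 * num_ext c predT)%N.
Proof.
move=> sK /= /andP[xc uc] Ax IH; rewrite !falling2S (num_ext_split _ xc).
rewrite (bigID (mem A)) /= [X in (_ + X)%N]big1 ?addn0; last first.
  move=> y /andP[_ yA]; apply: eq_card0 => g; rewrite !inE /=.
  by have [->|] := eqVneq (g x) y; rewrite ?(negPf yA) ?andbF.
rewrite (eq_bigl (mem A)); last first.
  move=> y; rewrite andbC; case: (boolP (y \in A)) => //= yA.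
    by have /and3P[_ _ ->] := Ax _ yA.
  by rewrite (negPf yA).
rewrite big_distrl /= (eq_bigr (fun=> falling2 (#|A| - 2) n * num_ext c predT)%N).
  by rewrite sum_nat_const mulnA.
move=> y yA; have /and3P[_ _ yx] := Ax _ yA.
rewrite (num_ext_step uc xc yx) mulnCA [in RHS]mulnCA; congr (_ * _)%N.
rewrite -(IH _ yA) -subnDA; congr (_ * _)%N; apply: eq_card => g; rewrite !inE /=.
by have [->|] := eqVneq (g x) y; rewrite ?yA ?andbF.
Qed.

(** Iterating [num_ext_walk_step] shows that only the total number of steps matters, not how it is
    shared among the walks. The invariant is that [A] is a union of untouched vertices of degree
    2. *)
Lemma num_ext_walks K xs k x c A :
  involutive s -> uniq (x :: xs ++ supp c) ->
  (forall y, y \in A -> [&& s y \in A, s y != y & y \notin x :: xs ++ supp c]) ->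
  (num_ext c (walk (walks K xs) k x A)
     * falling2 (#|H| - (size c).*2 - 1) (k + K * size xs) =
   falling2 #|A| (k + K * size xs) * num_ext c predT)%N.
Proof.
(* The induction on the steps of the current walk serves both cases of the induction on [xs]; its
   premise treats the moment when that walk has ended. *)
move=> sK; have step xs' k' :
  (forall x c A, uniq (x :: xs' ++ supp c) ->
    (forall y, y \in A -> [&& s y \in A, s y != y & y \notin x :: xs' ++ supp c]) ->
    (num_ext c (walk (walks K xs') 0 x A)
       * falling2 (#|H| - (size c).*2 - 1) (K * size xs') =
     falling2 #|A| (K * size xs') * num_ext c predT)%N) ->
  (forall x c A, uniq (x :: xs' ++ supp c) ->
    (forall y, y \in A -> [&& s y \in A, s y != y & y \notin x :: xs' ++ supp c]) ->
    (num_ext c (walk (walks K xs') k' x A)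
       * falling2 (#|H| - (size c).*2 - 1) (k' + K * size xs') =
     falling2 #|A| (k' + K * size xs') * num_ext c predT)%N).
  move=> base; elim: k' => [|{}k IHk] {}x {}c {}A ux Ax; first exact: base.
  have [xn]: x \notin xs' ++ supp c /\ uniq (xs' ++ supp c) by case/andP: ux.
  rewrite cat_uniq => /and3P[uxs dis uc].
  rewrite addSn; apply: num_ext_walk_step => //=.
  - by rewrite uc andbT; apply: contra xn => xc; rewrite mem_cat xc orbT.
  - move=> y /Ax /and3P[-> ->]; rewrite !inE mem_cat !negb_or.
    by case/and3P=> -> _ ->.
  move=> y yA; have /and3P[syA sy yn] := Ax _ yA.
  have -> : (#|A| - 2 = #|A :\: [set y; s y]%SET|)%N.
    rewrite cardsD (finset.setIidPr _) ?cards2 1?eq_sym ?sy //.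
    by apply/fintype.subsetP => z; rewrite !inE => /orP[] /eqP ->.
  have -> : (#|H| - (size c).*2 - 3 = #|H| - (size ((x, y) :: c)).*2 - 1)%N.
    by rewrite /= doubleS -!subnDA addn1 addn3.
  have perm : perm_eq (xs' ++ supp ((x, y) :: c)) [:: x, y & xs' ++ supp c].
    by apply/seq.permP => p; rewrite /supp /= !count_cat /= !count_cat /=; lia.
  have /and3P[_ _ syn] := Ax _ syA.
  apply: IHk => [|z] /=.
    rewrite (perm_mem perm) (perm_uniq perm) /= !inE !negb_or sy /=.
    move: yn syn; rewrite !inE !negb_or => /andP[yx ->] /andP[-> ->] /=.
    by rewrite eq_sym yx xn cat_uniq uxs dis.
  rewrite !inE (perm_mem perm) !inE !negb_or => /andP[/andP[zy zsy] zA].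
  have /and3P[-> -> /=] := Ax _ zA; rewrite inE negb_or => /andP[zx zn].
  by rewrite (inj_eq (inv_inj sK)) zy zsy zx zn (can2_eq sK sK) zsy.
elim: xs k x c A => [|x' xs IHxs] k x c A ux Ax; apply: step ux Ax => {}x {}c {}A ux Ax.
  by rewrite muln0 /falling2 !big_ord0 mul1n muln1.
rewrite mulnS; apply: IHxs => [|y /Ax]; first by case/andP: ux.
by rewrite !inE !negb_or => /and3P[-> -> /and3P[_ -> ->]].
Qed.

End WalkCount.

(** * Walks and components *)

Section WalkGeometry.
Variables (H V : finType) (s : H -> H) (tg : H -> V) (g : {ffun H -> H}).
Hypotheses (sK : involutive s) (gm : matching g).
Hypotheses (tg_s : forall h, tg (s h) = tg h).
Hypotheses (tg_eq : forall h h', tg h = tg h' -> (h' == h) || (h' == s h)).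
Implicit Types (A W E : {set H}).

Let gK := matchingK gm.

(** Connectivity is studied on half-edges: [s] exchanges the half-edges of a vertex and fixes that
    of a leaf, and [g] crosses an edge. *)
Definition hlink (g : {ffun H -> H}) : rel H := [rel x y | (y == s x) || (y == g x)].

Definition hconn (g : {ffun H -> H}) : rel H := connect (hlink g).

Lemma hconn_sym : connect_sym (hlink g).
Proof.
apply: sym_connect_sym => x y.
by rewrite /hlink /= ![y == _]eq_sym (can2_eq sK sK) (can2_eq gK gK).
Qed.

Lemma hconn_refl x : hconn g x x. Proof. exact: connect0. Qed.

Lemma hconn_trans : transitive (hconn g). Proof. exact: connect_trans. Qed.

Lemma hconn_s x : hconn g x (s x).
Proof. by apply: connect1; rewrite /hlink /= eqxx. Qed.

Lemma hconn_g x : hconn g x (g x).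
Proof. by apply: connect1; rewrite /hlink /= eqxx orbT. Qed.

Lemma hconn_closed W x y :
  (forall z, z \in W -> s z \in W) -> (forall z, z \in W -> g z \in W) ->
  x \in W -> hconn g x y -> y \in W.
Proof.
move=> sW gW xW /connectP[p + ->]; elim: p x xW => //= z p IH x xW /andP[xz].
by apply: IH; case/orP: xz => /eqP->; [apply: sW | apply: gW].
Qed.

(* The component of a fixed point [h] of [s] is the orbit of [h] under [g \o s],
   and [s] acts on that cycle as a reflection, so it has at most two fixed
   points there. *)
Lemma hconn_fixed_uniq h h1 h2 :
  s h = h -> s h1 = h1 -> s h2 = h2 -> h1 != h -> h2 != h ->
  hconn g h h1 -> hconn g h h2 -> h1 = h2.
Proof.
move=> sh; pose f z := g (s z).
have fI : injective f by move=> a b /(can_inj gK)/(can_inj sK).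
(* This is [s (f^i h) = f^(-i) h], the reflection of the orbit; a second fixed point thus satisfies
   [f^(2 i) h = h] and lies at half the period. *)
have sf i : iter i f (s (iter i f h)) = h.
  elim: i => [|i IHi]; first exact: sh.
  by rewrite iterSr iterS /f sK gK -/f.
have half y : s y = y -> y != h -> hconn g h y ->
    (findex f h y).*2 = fingraph.order f h /\ y = iter (findex f h y) f h.
  move=> sy yh hy; have fy : fconnect f h y.
    have sO z : z \in [set z | fconnect f h z]%SET -> s z \in [set z | fconnect f h z]%SET.
      rewrite !inE => /iter_findex <-; elim: (findex _ _ _) => [|i IHi].
        by rewrite /= sh connect0.
      apply: connect_trans IHi _; rewrite (fconnect_sym fI); set u := s (iter i f h).
      have -> : u = f (s (iter i.+1 f h)) by rewrite iterS /f sK gK.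
      exact: fconnect1.
    have := hconn_closed sO _ _ hy; rewrite !inE connect0; apply => // z.
    by rewrite -{2}[z]sK => /sO; rewrite !inE => /connect_trans; apply; apply: fconnect1.
  move: (findex f h y) (iter_findex fy) (findex_max fy) => i yE ir; split=> //.
  have := sf i; rewrite yE sy -yE -iterD addnn.
  have [ri|ri] := ltnP i.*2 (fingraph.order f h).
    move/(congr1 (findex f h)); rewrite findex_iter // findex0 => i0.
    have {}i0 : i = 0%N by lia.
    by rewrite -yE i0 eqxx in yh.
  rewrite -(subnK ri) iterD iter_order // => /(congr1 (findex f h)).
  by rewrite findex_iter ?findex0; lia.
move=> s1 s2 n1 n2 /(half _ s1 n1)[e1 ->] /(half _ s2 n2)[e2 ->].
by congr (iter _ f h); apply: double_inj; rewrite e1.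
Qed.

Local Notation free_walk := (walk s (fun=> predT)).

Lemma hconn_step x y : hconn g (s (g x)) y -> hconn g x y.
Proof. by apply: hconn_trans; apply: hconn_trans (hconn_g x) (hconn_s _). Qed.

(** Only the final test can fail; [A1] is what is left at that moment, and the walk removes only
    half-edges of its own component. *)
Lemma walk_reach P k x A : free_walk k x A g -> ~~ walk s P k x A g ->
  exists A1 : {set H}, [/\ A1 \subset A,
    forall z, z \in A -> z \notin A1 -> hconn g x z & ~~ P A1 g].
Proof.
elim: k x A => [|k IH] x A /=; first by move=> _ PA; exists A; split=> // z ->.
case/andP=> gA w; rewrite gA /= => /(IH _ _ w)[A1 [sA1 A1P PA1]].
exists A1; split=> // [|z zA zA1]; first exact: fintype.subset_trans sA1 (subsetDl _ _).
have [/set2P[]->|zn] := boolP (z \in [set g x; s (g x)]%SET).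
- exact: hconn_g.
- exact: hconn_trans (hconn_g x) (hconn_s _).
by apply: hconn_step; apply: A1P; rewrite // finset.in_setD zn.
Qed.

Lemma walk_subset k x A A1 : A1 \subset A -> free_walk k x A g ->
  ~~ free_walk k x A1 g -> exists z, [/\ z \in A, z \notin A1 & hconn g x z].
Proof.
elim: k x A A1 => //= k IH x A A1 A1A /andP[gA w].
have [gA1 /= w1|gA1 _] := boolP (g x \in A1); last by exists (g x); rewrite gA hconn_g.
have [|z [zA zA1 xz]] := IH _ _ _ _ w w1; first exact: finset.setSD.
exists z; move: zA zA1; rewrite !finset.in_setD => /andP[-> ->].
by rewrite /= => ->; split=> //; apply: hconn_step.
Qed.

(** The second walk survives on its own, so only a half-edge that the first has used up can stop it;
    this half-edge lies in both components. *)
Lemma walk_pair_connected K h h' A :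
  free_walk K h A g -> free_walk K h' A g ->
  ~~ walk s (walks s K [:: h']) K h A g -> hconn g h h'.
Proof.
move=> w w' /(walk_reach w)[A1 [A1A A1P /(walk_subset A1A w')[z [zA zA1 h'z]]]].
by apply: hconn_trans (A1P _ zA zA1) _; rewrite /hconn hconn_sym.
Qed.

Definition vcomp (g : {ffun H -> H}) x := tg @: [set z | hconn g x z]%SET.

Lemma eq_vcomp x y : hconn g x y -> vcomp g x = vcomp g y.
Proof.
move=> xy; rewrite /vcomp.
rewrite (_ : [set z | hconn g x z] = [set z | hconn g y z])%SET //.
by apply/finset.setP => z; rewrite !inE; apply: same_connect hconn_sym _ _ xy z.
Qed.

(** [W] is the set visited so far. Since it is closed under [s] and disjoint from [A], every step
    enters a new vertex. *)
Lemma walk_size k x A W :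
  (forall y, y \in A -> s y \in A) -> (forall y, y \in W -> s y \in W) ->
  [disjoint A & W] -> (forall y, y \in W -> hconn g x y) ->
  free_walk k x A g -> (#|tg @: W| + k <= #|vcomp g x|)%N.
Proof.
elim: k x A W => [|k IH] x A W sA sW dAW Wx /=.
  move=> _; rewrite addn0; apply/subset_leq_card/imsetS.
  by apply/fintype.subsetP => y /Wx; rewrite inE.
case/andP=> gA /(IH _ _ (g x |: (s (g x) |: W))%SET) IHw.
have xsgx : hconn g x (s (g x)) by apply: hconn_trans (hconn_g x) (hconn_s _).
have gW : g x \notin W by rewrite (disjointFr dAW).
rewrite (eq_vcomp xsgx).
apply: leq_trans (IHw _ _ _ _) => [|y|y||y].
- rewrite addnS -addSn leq_add2r !imsetU1 tg_s finset.setUA finset.setUid cardsU1.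
  rewrite (_ : tg (g x) \notin _) //; apply/imsetP => -[y yW] /esym/tg_eq.
  case/orP=> /eqP gy; rewrite gy ?yW in gW => //.
  by rewrite sW in gW.
- rewrite !inE !negb_or => /andP[/andP[n1 n2] /sA->].
  by rewrite (inj_eq (inv_inj sK)) n1 (can2_eq sK sK) n2.
- rewrite !inE => /or3P[/eqP->|/eqP->|/sW->]; rewrite ?sK ?eqxx ?orbT //.
- rewrite disjoint_subset; apply/fintype.subsetP => y; rewrite !inE !negb_or.
  by case/andP=> /andP[-> ->] yA; rewrite (disjointFr dAW).
have E : hconn g (s (g x)) =1 hconn g x.
  by move=> z; symmetry; apply: same_connect hconn_sym _ _ xsgx z.
rewrite !inE !E => /or3P[/eqP->|/eqP->|/Wx //]; [exact: hconn_g|exact: xsgx].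
Qed.

(* [W] is the set of half-edges visited so far. Besides the current exit [x], only
   those in [E] may be matched to the outside of [W]: [E] is the half-edge through
   which the initial vertex was not left, and is empty if that vertex is a leaf.
   A walk that stops thus either has reached a leaf or has closed a cycle. *)
Lemma walk_closed k x E W :
  (forall y, y \in W -> s y \in W) -> x \in W -> x \notin E -> E \subset W ->
  (#|E| <= 1)%N ->
  (forall y, y \in W -> y != x -> y \notin E -> [&& g y \in W, g y != x & g y \notin E]) ->
  (forall z, hconn g x z -> s z = z -> E = finset.set0) ->
  ~~ free_walk k x ([set y | s y != y] :\: W)%SET g ->
  (#|vcomp g x| <= #|tg @: W| + k)%N.
Proof.
have fin (U : {set H}) i z : (forall y, y \in U -> s y \in U) -> (forall y, y \in U -> g y \in U) ->
    z \in U -> (#|tg @: U| <= i)%N -> (#|vcomp g z| <= i)%N.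
  move=> sU gU xU; apply: leq_trans; apply: subset_leq_card; apply: imsetS.
  apply/fintype.subsetP => y.
  by rewrite inE; apply: hconn_closed.
elim: k x W => //= k IH x W sW xW xE EW E1 gW noE.
have gxx : g x != x by apply: matching_neq.
have xgx : hconn g x (s (g x)) by apply: hconn_trans (hconn_g x) (hconn_s _).
have [gxA /=|gxA _] := boolP (g x \in _); last first.
  (* A return to [W]: all of [W] outside [x] and [E] is already matched within itself, so the
     partner of [x] is the element of [E], and [W] is closed under [g]. *)
  have [gxW|gxW] := boolP (g x \in W).
    apply: (fin W) => //; last exact: leq_addr.
    have gxE : g x \in E.
      by apply: contraTT xW => gxE; have := gW _ gxW gxx gxE; rewrite gK eqxx andbF.
    move=> y yW; have [->//|yx] := eqVneq y x.
    have [yE|yE] := boolP (y \in E); last by case/and3P: (gW _ yW yx yE).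
    by rewrite (card_le1_eqP E1 _ _ gxE yE) gK.
  (* A leaf is reached: [E] is empty by [noE], and [W] together with the leaf is closed. *)
  have sgx : s (g x) = g x.
    by apply/eqP; apply: contraNT gxA => sgx; rewrite !inE gxW.
  have E0 : E = finset.set0 by apply: (noE (g x)); rewrite ?hconn_g.
  apply: (fin (g x |: W)%SET) => [y|y||]; last 2 first.
  - by rewrite !inE xW orbT.
  - rewrite imsetU1; apply: leq_trans (leq_card_setU _ _) _.
    by rewrite cards1 addnC leq_add2l.
  - by rewrite !inE => /orP[/eqP->|/sW->]; rewrite ?sgx ?eqxx ?orbT.
  rewrite !inE => /orP[/eqP->|yW]; first by rewrite gK xW orbT.
  have [->|yx] := eqVneq y x; first by rewrite eqxx.
  have yE : y \notin E by rewrite E0 inE.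
  by have /and3P[-> _ _] := gW _ yW yx yE; rewrite orbT.
rewrite finset.setDDl => w; move: gxA; rewrite !inE => /andP[gxW sgx].
have sgxW : s (g x) \notin W by apply: contra gxW => /sW; rewrite sK.
rewrite (eq_vcomp xgx).
have EN y : y \notin W -> y \notin E by apply: contra => /(fintype.subsetP EW).
apply: leq_trans (IH _ _ _ _ _ _ _ _ _ w) _ => //.
- by move=> y; rewrite !inE => /or3P[/sW->|/eqP->|/eqP->]; rewrite ?sK ?eqxx ?orbT.
- by rewrite !inE eqxx !orbT.
- exact: EN.
- by apply: fintype.subset_trans EW (finset.subsetUl _ _).
- move=> y; rewrite !inE => /or3P[yW|/eqP-> _ _|/eqP->]; last by rewrite eqxx.
    have [-> _ _|yx _ yE] := eqVneq y x.
      by rewrite eqxx orbT eq_sym sgx EN.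
    case/and3P: (gW _ yW yx yE) => gyW gyx ->; rewrite gyW /= andbT.
    by apply: contraNneq sgxW => <-.
  by rewrite gK xW xE andbT /=; apply: contraNneq sgxW => <-.
- by move=> z xz; apply: noE; apply: hconn_trans xgx xz.
rewrite imsetU addnS -addSn leq_add2r; apply: leq_trans (leq_card_setU _ _) _.
rewrite -addn1 leq_add2l (_ : _ @: _ = [set tg (g x)])%SET ?cards1 //.
by rewrite imsetU !imset_set1 tg_s finset.setUid.
Qed.

End WalkGeometry.

(** * First and second moments *)

Section MatchingMoments.
Variables (H V : finType) (s : H -> H) (tg : H -> V).
Hypotheses (sK : involutive s).
Hypotheses (tg_s : forall h, tg (s h) = tg h).
Implicit Types (g : {ffun H -> H}).

Local Notation num := (num_ext (Nil (H * H))).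

Definition fixed_set := [set h | s h == h]%SET.
Definition moved_set := [set h | s h != h]%SET.

(** Leaving through [s h] treats both degrees alike: a leaf is left through [h] itself, a vertex of
    degree 2 as if it had been entered at [h]. *)
Definition survives K h g :=
  walk s (fun=> predT) K (s h) (moved_set :\: [set h; s h])%SET g.

Definition survives2 K h h' g := walk s (walks s K [:: h']) K h moved_set g.

Lemma survives_fixed K h g : h \in fixed_set ->
  survives K h g = walk s (fun=> predT) K h moved_set g.
Proof.
rewrite inE => /eqP sh; rewrite /survives sh finset.setUid; congr walk.
by apply/finset.setDidPl; rewrite disjoint_sym disjoints1 inE sh eqxx.
Qed.

Lemma card_fixedC : (#|moved_set| = #|H| - #|fixed_set|)%N.
Proof.
rewrite -(cardsC fixed_set) addKn; apply: eq_card => h.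
by rewrite !inE.
Qed.

Lemma num_survives_fixed K h : h \in fixed_set ->
  (num (survives K h) * falling2 (#|H| - 1) K =
   falling2 #|moved_set| K * num predT)%N.
Proof.
move=> hF; have := @num_ext_walks H s K [::] K h [::] moved_set sK.
rewrite /= muln0 addn0 subn0 => <- //.
  by congr (_ * _)%N; apply: eq_card => g; rewrite !inE survives_fixed.
move=> y; rewrite !inE (inj_eq (inv_inj sK)) => sy.
by rewrite sy; apply: contraNneq sy => ->; rewrite inE in hF.
Qed.

Lemma num_survives2 K h h' : h \in fixed_set -> h' \in fixed_set -> h != h' ->
  (num (survives2 K h h') * falling2 (#|H| - 1) (K + K) =
   falling2 #|moved_set| (K + K) * num predT)%N.
Proof.
rewrite !inE => /eqP sh /eqP sh' hh'.
have := @num_ext_walks H s K [:: h'] K h [::] moved_set sK.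
rewrite /= muln1 subn0 !inE hh' => -> // y; rewrite !inE (inj_eq (inv_inj sK)) => sy.
by rewrite sy /= negb_or; apply/andP; split; apply: contraNneq sy => ->; apply/eqP.
Qed.

Lemma num_survives_moved K h : h \in moved_set ->
  (num (survives K h) * falling2 (#|H| - 1) K =
   falling2 (#|moved_set| - 2) K * num predT)%N.
Proof.
rewrite inE => hM.
have -> : (#|moved_set| - 2 = #|moved_set :\: [set h; s h]%SET|)%N.
  rewrite cardsD (finset.setIidPr _) ?cards2 1?eq_sym ?hM //.
  by apply/fintype.subsetP => z; rewrite !inE => /orP[] /eqP ->; rewrite // sK eq_sym.
have := @num_ext_walks H s K [::] K (s h) [::] (moved_set :\: [set h; s h])%SET sK.
rewrite /= muln0 addn0 subn0 => <- // y; rewrite !inE !negb_or.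
case/andP=> /andP[yh ysh] sy.
by rewrite !(inj_eq (inv_inj sK)) (can2_eq sK sK) yh ysh sy.
Qed.

(** By [walk_closed] from the vertex of [h], a walk stopped within [K] steps bounds its component by
    [K + 1] vertices. The condition on fixed points is there because a walk started inside a path
    can meet one end without seeing the other part. *)
Lemma survives_of_large_vcomp K g h : matching g ->
  (forall z, hconn s g h z -> s z = z -> s h = h) ->
  (K.+1 < #|vcomp s tg g h|)%N -> survives K h g.
Proof.
move=> gm noF; rewrite ltnNge; apply: contraNT => ns.
rewrite (eq_vcomp tg sK gm (hconn_s s g h)).
pose E := if s h == h then finset.set0 else [set h]%SET.
have W1 : (#|[set tg x | x in [set h; s h]]|%SET = 1)%N.
  by rewrite imsetU !imset_set1 tg_s finset.setUid cards1.
rewrite -addn1 addnC -W1; apply: (walk_closed sK gm tg_s (E := E)) ns.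
- by move=> y; rewrite !inE => /orP[]/eqP->; rewrite ?sK eqxx ?orbT.
- by rewrite !inE eqxx orbT.
- by rewrite /E; case: eqVneq => sh; rewrite inE ?sh.
- by rewrite /E; case: eqP => _; rewrite ?finset.sub0set // finset.sub1set !inE eqxx.
- by rewrite /E; case: eqP => _; rewrite ?cards0 ?cards1.
- move=> y; rewrite !inE /E; have [-> /=|sh /=] := eqVneq (s h) h.
    by rewrite orbb => ->.
  by rewrite !inE orbC => /orP[] ->.
move=> z hz sz; rewrite /E ifT //; apply/eqP; apply: noF sz.
by apply: connect_trans (hconn_s _ _ _) hz.
Qed.

(* A large component either contains a leaf, whose walk survives, or is a cycle, and
   then the walks from all of its half-edges survive. *)
Lemma large_vcomp_bound K g h : matching g -> (K.+1 < #|vcomp s tg g h|)%N ->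
  (K.+2 <= K.+2 * #|[set x in fixed_set | survives K x g]|
           + #|[set x in moved_set | survives K x g]|)%N.
Proof.
move=> gm hK.
have vE z : hconn s g h z -> vcomp s tg g z = vcomp s tg g h.
  by move/(eq_vcomp tg sK gm).
have [/existsP[z /andP[hz sz]]|noF] := boolP [exists z, hconn s g h z && (s z == z)].
  apply: leq_trans (leq_addr _ _); rewrite -[leqLHS]muln1 leq_mul2l /= card_gt0.
  apply/set0Pn; exists z; rewrite !inE sz /=; apply: survives_of_large_vcomp => //.
    by move=> ? _ _; apply/eqP.
  by rewrite vE.
apply: leq_trans (leq_addl _ _); apply: (leq_trans hK).
apply: leq_trans (leq_imset_card _ _) _; apply: subset_leq_card.
have noF' z : hconn s g h z -> s z != z.
  by move=> hz; apply: contra noF => sz; apply/existsP; exists z; rewrite hz.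
apply/fintype.subsetP => z; rewrite !inE => hz; rewrite noF' //=.
apply: (survives_of_large_vcomp gm) => [y zy sy|]; last by rewrite vE.
by have := noF' _ (connect_trans hz zy); rewrite sy eqxx.
Qed.

End MatchingMoments.

(** * Markov and Chebyshev bounds *)

Section MatchingTails.
Variables (R : realType) (H V : finType) (s : H -> H) (tg : H -> V).
Hypotheses (sK : involutive s).
Hypotheses (tg_s : forall h, tg (s h) = tg h).
Hypotheses (tg_eq : forall h h', tg h = tg h' -> (h' == h) || (h' == s h)).
Implicit Types (g : {ffun H -> H}).

Local Notation num := (num_ext (Nil (H * H))).
Local Notation F := (fixed_set s).
Local Notation M := (moved_set s).

Definition num_survivors K g := #|[set h in F | survives s K h g]%SET|.

(** A path has two ends: based at one leaf, [hconn_fixed_uniq] identifies any two further ones. *)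
Lemma card_hconn_fixed g h : matching g -> (#|[set h' in F | hconn s g h h']%SET| <= 2)%N.
Proof.
move=> gm; rewrite leqNgt; apply/negP => /card_gt2P[x [y [z [[xF yF zF] [xy yz zx]]]]].
move: xF yF zF; rewrite !inE => /andP[/eqP sx hx] /andP[/eqP sy hy] /andP[/eqP sz hz].
have xh : hconn s g x h by rewrite /hconn (hconn_sym sK gm).
move/eqP: yz; apply; apply: (hconn_fixed_uniq sK gm sx sy sz) => //; first by rewrite eq_sym.
  exact: hconn_trans xh hy.
exact: hconn_trans xh hz.
Qed.

Lemma sum_survives K g : num_survivors K g = (\sum_(h in F) survives s K h g)%N.
Proof.
rewrite /num_survivors -sum1_card big_mkcond [RHS]big_mkcond /=.
by apply: eq_bigr => h _; rewrite inE; case: (h \in F); case: survives.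
Qed.

(* Two surviving walks from leaves that do not survive jointly meet, so their leaves
   are the two ends of the same path. *)
Lemma num_survivors_sqr K g : matching g ->
  (num_survivors K g * num_survivors K g <=
   2 * num_survivors K g
     + \sum_(h in F) \sum_(h' in F | h != h') survives2 s K h h' g)%N.
Proof.
move=> gm; rewrite {1 3}sum_survives big_distrl big_distrr -big_split /=.
apply: leq_sum => h hF; rewrite sum_survives big_distrr /=.
have [hs|_] := boolP (survives s K h g); last first.
  by rewrite big1 // => i _; rewrite mul0n.
apply: leq_trans (_ : \sum_(i in F) (hconn s g h i + (h != i) * survives2 s K h i g) <= _)%N.
  apply: leq_sum => i iF; rewrite mul1n; have [->|hi /=] := eqVneq h i.
    by rewrite hconn_refl addn0 leq_b1.
  have [is_|//] := boolP (survives s K i g); rewrite mul1n addnC.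
  have [//|n2] := boolP (survives2 s K h i g).
  rewrite (walk_pair_connected sK gm _ _ n2) //; first by rewrite -survives_fixed.
  by rewrite -survives_fixed.
rewrite big_split /= leq_add //.
  rewrite muln1; apply: leq_trans (card_hconn_fixed h gm).
  rewrite -sum1_card big_mkcond [leqRHS]big_mkcond; apply: leq_sum => i _.
  by rewrite inE; case: (i \in F); case: hconn.
rewrite [leqLHS]big_mkcond [leqRHS]big_mkcond; apply: leq_sum => i _ /=.
by case: (i \in F); case: (h != i); rewrite ?mul1n ?mul0n.
Qed.

Lemma survives_vcomp K g h : matching g -> h \in F -> survives s K h g ->
  (K < #|vcomp s tg g h|)%N.
Proof.
move=> gm hF; rewrite survives_fixed // => w.
rewrite -[K.+1]add1n -(cards1 (tg h)) -imset_set1.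
move: hF; rewrite inE => /eqP sh; apply: (walk_size sK gm tg_s tg_eq _ _ _ _ w).
- by move=> y; rewrite !inE (inj_eq (inv_inj sK)).
- by move=> y; rewrite !inE => /eqP->; rewrite sh.
- by rewrite disjoint_sym disjoints1 inE sh eqxx.
by move=> y; rewrite inE => /eqP->; apply: hconn_refl.
Qed.

Lemma vcompP g h h' : matching g ->
  reflect (vcomp s tg g h = vcomp s tg g h') (hconn s g h h').
Proof.
move=> gm; apply: (iffP idP) => [|E]; first exact: eq_vcomp.
have : tg h' \in vcomp s tg g h'.
  by apply/imsetP; exists h'; rewrite ?inE ?hconn_refl.
rewrite -E => /imsetP[z + /esym/tg_eq]; rewrite inE => hz /orP[/eqP->//|/eqP->].
exact: hconn_trans hz (hconn_s _ _ _).
Qed.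

Lemma num_survivors_vcomp K g : matching g ->
  (num_survivors K g <=
   2 * #|[set vcomp s tg g h | h in [set h in F | survives s K h g]]|%SET)%N.
Proof.
move=> gm; rewrite /num_survivors; set S := [set h in F | _]%SET.
rewrite -sum1_card (partition_big_imset (vcomp s tg g)) /= mulnC -sum_nat_const.
apply: leq_sum => C /imsetP[h hS ->]; apply: leq_trans (card_hconn_fixed h gm).
rewrite sum1_card; apply: subset_leq_card; apply/fintype.subsetP => x.
rewrite unfold_in !inE => /andP[/andP[-> _] /eqP E].
by apply/vcompP.
Qed.

Lemma sum_bool_num (I : finType) (B : {pred I}) (Q : I -> pred {ffun H -> H}) :
  (\sum_(g | matching g) \sum_(i in B) Q i g = \sum_(i in B) num (Q i))%N.
Proof.
rewrite exchange_big; apply: eq_bigr => i _; rewrite /num_ext -sum1_card.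
rewrite big_mkcond [RHS]big_mkcond; apply: eq_bigr => g _ /=.
by rewrite inE; case: (matching g); case: (Q i g).
Qed.

Lemma num_predT : num (predT : pred {ffun H -> H}) = #|[pred g : {ffun H -> H} | matching g]|.
Proof. by apply: eq_card => g; rewrite !inE /= andbT. Qed.

Section Probability.
Local Open Scope ring_scope.
Variable K : nat.
Hypotheses (F_gt0 : (0 < #|F|)%N) (KM : (4 * K <= #|M|)%N).

Definition survival_prob : R :=
  (falling2 #|M| K)%:R / (falling2 (#|H| - 1) K)%:R.

Local Notation p := survival_prob.
Local Notation N := ((num (predT : pred {ffun H -> H}))%:R : R).

Let M_lt : (#|M| < #|H|)%N.
Proof. by have := cardsC F; rewrite card_fixedC; lia. Qed.

(** Joint survival of two walks has [K + K] factors; [KM] keeps their denominators positive. *)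
Let den_gt0 k : (k <= K + K)%N -> 0 < (falling2 (#|H| - 1) k)%:R :> R.
Proof. by move=> kK; rewrite ltr0n falling2_gt0 //; lia. Qed.

Lemma survival_prob_ge0 : 0 <= p.
Proof. by rewrite divr_ge0. Qed.

Lemma num_survives_fixedR h : h \in F -> (num (survives s K h))%:R = p * N.
Proof.
move=> hF; have d0 := den_gt0 (leq_addr K K).
apply: (mulIf (lt0r_neq0 d0)).
rewrite -natrM num_survives_fixed // natrM mulrAC divfK //.
exact: lt0r_neq0.
Qed.

Lemma num_survives_movedR h : h \in M -> (num (survives s K h))%:R <= p * N.
Proof.
move=> hM; have d0 := den_gt0 (leq_addr K K).
rewrite -(ler_pM2r d0) -natrM num_survives_moved // mulrAC divfK ?gt_eqF // -natrM.
rewrite ler_nat leq_mul2r leq_prod ?orbT // => i _; lia.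
Qed.

(** Of the [K + K] factors the last [K] are shifted by [2 * K], and [falling2_ratio] bounds their
    product by [p]. *)
Lemma num_survives2R h h' : h \in F -> h' \in F -> h != h' ->
  (num (survives2 s K h h'))%:R <= p ^+ 2 * N.
Proof.
move=> hF h'F hh'; have d2 := den_gt0 (leqnn (K + K)); have d1 := den_gt0 (leq_addr K K).
rewrite -(ler_pM2r d2) -natrM num_survives2 // natrM mulrAC ler_wpM2r //.
rewrite expr2 /survival_prob mulf_div mulrAC ler_pdivlMr ?mulr_gt0 // -!natrM ler_nat.
rewrite !falling2D -!mulnA leq_mul2l; apply/orP; right.
have := @falling2_ratio #|M| (#|H| - 1)%N K K.*2.
set u := falling2 _ _; set v := falling2 _ _; set x := falling2 _ _; set y := falling2 _ _.
have : (#|M| <= #|H| - 1)%N by lia.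
nia.
Qed.

Lemma num_sumR (Q : pred {ffun H -> H}) :
  (num Q)%:R = \sum_(g | matching g) (Q g)%:R :> R.
Proof.
rewrite -natr_sum /num_ext -sum1_card big_mkcond [in RHS]big_mkcond.
by congr _%:R; apply: eq_bigr => g _ /=; rewrite inE; case: (matching g); case: (Q g).
Qed.

(** Markov's inequality for the weighted number of surviving walks in [large_vcomp_bound], which is
    at least [K + 2] on the bad event. *)
Lemma num_large_vcomp :
  (num (fun g => [exists x, K.+1 < #|vcomp s tg g x|]%N))%:R <=
  (#|F|%:R * p + #|M|%:R * p / K.+2%:R) * N.
Proof.
set Bad := (fun g => _).
have : (K.+2 * num Bad <= K.+2 * \sum_(h in F) num (survives s K h)
         + \sum_(h in M) num (survives s K h))%N.
  rewrite -!sum_bool_num big_distrr -big_split /=.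
  rewrite (_ : num Bad = \sum_(g | matching g) Bad g)%N; last first.
    by apply/eqP; rewrite -(eqr_nat R) num_sumR -natr_sum.
  rewrite big_distrr; apply: leq_sum => g gm /=.
  have [/existsP[h hK]|_] := boolP (Bad g); last by rewrite muln0.
  have bsum (B : {set H}) : (\sum_(i in B) survives s K i g =
      #|[set x in B | survives s K x g]|)%N.
    rewrite -sum1_card big_mkcond [RHS]big_mkcond; apply: eq_bigr => i _ /=.
    by rewrite inE; case: (i \in B); case: survives.
  by rewrite muln1 !bsum; apply: (large_vcomp_bound sK tg_s gm hK).
rewrite -(ler_nat R) natrD !natrM !natr_sum => le.
rewrite -(ler_pM2l (ltr0Sn R K.+1)); apply: (le_trans le).
have -> : K.+2%:R * ((#|F|%:R * p + #|M|%:R * p / K.+2%:R) * N) =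
    K.+2%:R * (#|F|%:R * (p * N)) + #|M|%:R * (p * N) by field.
rewrite lerD ?ler_pM2l //.
  by rewrite (eq_bigr (fun=> p * N)) ?sumr_const ?mulr_natl // => h /num_survives_fixedR.
rewrite mulr_natl -sumr_const; apply: ler_sum => h; exact: num_survives_movedR.
Qed.

Lemma num_few_survivors t : 0 < #|F|%:R * p -> (2 * t)%:R <= #|F|%:R * p ->
  (num (fun g => num_survivors K g < t)%N)%:R <= 8 / (#|F|%:R * p) * N.
Proof.
set mu := _ * p => mu0 tmu; set Bad := (fun g => _).
have S1 : \sum_(g | matching g) (num_survivors K g)%:R = mu * N :> R.
  rewrite -natr_sum (eq_bigr (fun g => \sum_(h in F) survives s K h g)%N); last first.
    by move=> g _; rewrite sum_survives.
  rewrite sum_bool_num natr_sum (eq_bigr (fun=> p * N)) => [|h /num_survives_fixedR //].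
  by rewrite sumr_const -[LHS]mulr_natl mulrA.
have S2 : \sum_(g | matching g) (num_survivors K g)%:R ^+ 2 <= (2 * mu + mu ^+ 2) * N :> R.
  rewrite mulrDl -mulrA -S1 mulr_sumr.
  apply: le_trans (_ : \sum_(g | matching g) (2 * (num_survivors K g)%:R +
     (\sum_(h in F) \sum_(h' in F | h != h') survives2 s K h h' g)%N%:R) <= _).
    by apply: ler_sum => g gm; rewrite expr2 -!natrM -natrD ler_nat num_survivors_sqr.
  rewrite big_split lerD2l /= -natr_sum exchange_big natr_sum /=.
  apply: le_trans (_ : \sum_(h in F) #|F|%:R * (p ^+ 2 * N) <= _); last first.
    by rewrite sumr_const -[leLHS]mulr_natl /mu; rewrite le_eqVlt; apply/orP; left; apply/eqP; ring.
  apply: ler_sum => h hF; rewrite sum_bool_num natr_sum.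
  apply: le_trans (_ : \sum_(h' in F | h != h') p ^+ 2 * N <= _).
    by apply: ler_sum => h' /andP[h'F]; apply: num_survives2R.
  rewrite sumr_const -[leLHS]mulr_natl ler_wpM2r ?mulr_ge0 ?sqr_ge0 // ler_nat.
  by apply: subset_leq_card; apply/fintype.subsetP => i; rewrite unfold_in => /andP[].
(* Chebyshev's inequality: the event forces a deviation of at least [mu / 2], the variance is at
   most [2 * mu], and [8 / mu] is [2 * mu] divided by [mu ^ 2 / 4]. *)
have -> : 8 / mu * N = (mu ^+ 2 / 4)^-1 * (2 * mu * N) by field; rewrite gt_eqF.
rewrite -ler_pdivrMl ?invrK ?invr_gt0 ?divr_gt0 ?exprn_gt0 //.
have : \sum_(g | matching g) ((num_survivors K g)%:R - mu) ^+ 2 <= 2 * mu * N.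
  rewrite (eq_bigr (fun g => ((num_survivors K g)%:R ^+ 2
      - 2 * mu * (num_survivors K g)%:R) + mu ^+ 2)); last by move=> g _; ring.
  rewrite big_split /= sumrB -mulr_sumr S1 sumr_const -num_predT -mulr_natr.
  by move: S2; lra.
apply: le_trans; rewrite num_sumR mulr_sumr; apply: ler_sum => g _.
rewrite /Bad; case: ltnP => [Zt|_]; last by rewrite mulr0 sqr_ge0.
have : (2 * num_survivors K g)%:R <= mu.
  by apply: le_trans tmu; rewrite ler_nat leq_mul2l ltnW.
rewrite natrM mulr1 => Zmu; rewrite -subr_ge0.
have -> : ((num_survivors K g)%:R - mu) ^+ 2 - mu ^+ 2 / 4 =
    (mu / 2 - (num_survivors K g)%:R) * (3 * mu / 2 - (num_survivors K g)%:R) by field.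
by apply: mulr_ge0; lra.
Qed.

End Probability.
End MatchingTails.

(** * The configuration model *)

Section Mate.
Variables (n : nat) (d : 'I_n -> nat).
Local Notation H := (half_edge d).
Implicit Types (M : perfect_matching d) (g : {ffun H -> H}).

Definition mate M : {ffun H -> H} :=
  [ffun h => odflt h [pick x | [set h; x]%SET \in val M]].

Lemma perfect_matching_partition M : finset.partition (val M) [set: H]%SET.
Proof. by case/andP: (valP M). Qed.

Lemma perfect_matching_card2 M e : e \in val M -> #|e| = 2%N.
Proof. by case/andP: (valP M) => _ /forall_inP eM /eM /eqP. Qed.

Lemma mate_in M h : [set h; mate M h]%SET \in val M.
Proof.
rewrite ffunE; case: pickP => //= none.
have /and3P[/eqP cov _ _] := perfect_matching_partition M.
have /bigcupP[e eM he] : h \in finset.cover (val M) by rewrite cov inE.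
have /eqP/cards2P[x [y [xy E]]] := perfect_matching_card2 eM.
move: he eM; rewrite E !inE => /orP[] /eqP<- eM; first by have := none y; rewrite eM.
by have := none x; rewrite finset.setUC eM.
Qed.

Lemma edgeE M h x : ([set h; x]%SET \in val M) = (x == mate M h).
Proof.
apply/idP/eqP => [hx|->]; last exact: mate_in.
have /and3P[_ tI _] := perfect_matching_partition M.
have E : [set h; x]%SET = [set h; mate M h]%SET.
  have hin y : h \in [set h; y]%SET by rewrite !inE eqxx.
  by rewrite -(def_pblock tI hx (hin _)) (def_pblock tI (mate_in M h) (hin _)).
have := perfect_matching_card2 hx; rewrite cards2.
have [->//|hx1 _] := eqVneq h x.
have : x \in [set h; mate M h]%SET by rewrite -E !inE eqxx orbT.
by rewrite !inE eq_sym (negPf hx1) => /eqP.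
Qed.

Lemma mate_matching M : matching (mate M).
Proof.
apply/forallP => h; rewrite eq_sym -edgeE finset.setUC mate_in /=.
apply: contraTneq (mate_in M h) => ->; rewrite finset.setUid.
by apply/negP => /perfect_matching_card2; rewrite cards1.
Qed.

Lemma mate_inj : injective mate.
Proof.
have half M M' : mate M = mate M' -> val M \subset val M'.
  move=> E; apply/fintype.subsetP => e eM.
  have /eqP/cards2P[x [y [xy eE]]] := perfect_matching_card2 eM.
  by move: eM; rewrite eE !edgeE E.
move=> M M' E; apply: val_inj; apply/eqP; rewrite finset.eqEsubset.
by rewrite !half.
Qed.

Lemma mate_surj g : matching g -> exists M, mate M = g.
Proof.
move=> gm; have gK := matchingK gm.
pose P := [set [set h; g h] | h in [set: H]]%SET.
have PP : is_perfect_matching P.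
  apply/andP; split; last first.
    apply/forall_inP => e /imsetP[h _ ->].
    by rewrite cards2 [h == _]eq_sym matching_neq.
  apply/and3P; split.
  - apply/eqP/finset.setP => h; rewrite inE; apply/bigcupP; exists [set h; g h]%SET.
      by apply: imset_f.
    by rewrite !inE eqxx.
  - apply/finset.trivIsetP => _ _ /imsetP[x _ ->] /imsetP[y _ ->]; apply: contraR.
    case/pred0Pn => z /=; rewrite !inE => /andP[].
    case/orP=> /eqP-> /orP[] /eqP E; rewrite ?E ?gK //; first by rewrite finset.setUC.
      by rewrite -E gK finset.setUC.
    by rewrite (can_inj gK E).
  by apply/imsetP => -[h _ /finset.setP/(_ h)]; rewrite !inE eqxx.
exists (Sub P PP); apply/ffunP => h; apply/esym/eqP; rewrite -edgeE SubK.
by apply: imset_f.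
Qed.

(** [mate] is a bijection onto the fixed-point-free involutions, so probabilities for a uniform
    matching become the counts studied above. *)
Lemma card_perfect_matching (Q : pred {ffun H -> H}) :
  #|[pred M | Q (mate M)]| = num_ext [::] Q.
Proof.
rewrite -(card_imset _ mate_inj); apply: eq_card => g; rewrite !inE /=.
apply/imsetP/andP => [[M + ->]|[gm Qg]]; first by rewrite inE mate_matching.
by have [M E] := mate_surj gm; exists M; rewrite ?inE E.
Qed.

End Mate.

(** * Half-edges and components when all degrees are 1 or 2 *)

Section DegreeOneTwo.
Variables (n : nat) (d : 'I_n -> nat).
Hypothesis d12 : forall i, (0 < d i <= 2)%N.
Local Notation H := (half_edge d).

(** Reversing ['I_(d i)] exchanges the two half-edges when [d i = 2] and fixes the only one when
    [d i = 1]. *)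
Definition sibling (h : H) : H := Tagged (fun i => 'I_(d i)) (rev_ord (tagged h)).

Lemma siblingK : involutive sibling.
Proof. by case=> i k; rewrite /sibling /= rev_ordK. Qed.

Lemma eq_tag_sibling h h' : tag h = tag h' -> (h' == h) || (h' == sibling h).
Proof.
case: h h' => i k [j l] /= E; case: _ / E l => l.
rewrite /sibling /= !eq_Tagged /= -!val_eqE /=.
by have := d12 i; have := ltn_ord k; have := ltn_ord l; lia.
Qed.

Lemma sibling_fixed h : (sibling h == h) = (d (tag h) == 1)%N.
Proof.
case: h => i k; rewrite /sibling /= eq_Tagged /= -val_eqE /=.
by have := d12 i; have := ltn_ord k; lia.
Qed.

Lemma card_half_edge : #|{: H}| = total_degree d.
Proof.
rewrite card_tagged sumnE big_map big_enum /=.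
by apply: eq_bigr => i _; rewrite card_ord.
Qed.

Lemma half_edge_at i : exists h : H, tag h = i.
Proof. by have /andP[d0 _] := d12 i; exists (Tagged (fun i => 'I_(d i)) (Ordinal d0)). Qed.

Lemma card_fixed_sibling : #|fixed_set sibling| = num_deg d 1.
Proof.
rewrite -(card_in_imset (f := tag)) => [|h h']; last first.
  rewrite !inE => /eqP sh _ /eq_tag_sibling; rewrite sh orbb => /eqP//.
apply: eq_card => i; rewrite !inE; apply/imsetP/idP => [[h + ->]|di].
  by rewrite inE sibling_fixed.
by have [h hi] := half_edge_at i; exists h; rewrite ?inE ?sibling_fixed ?hi.
Qed.

Lemma total_degree_eq : (total_degree d = num_deg d 1 + 2 * (n - num_deg d 1))%N.
Proof.
have -> : (n - num_deg d 1 = #|[predC [pred i | d i == 1%N]]|)%N.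
  have E : (num_deg d 1 + #|[predC [pred i | d i == 1%N]]| = n)%N.
    by rewrite /num_deg cardC card_ord.
  by rewrite -[X in (X - _)%N]E addKn.
rewrite /num_deg mulnC -sum_nat_const -[#|_|]sum1_card /total_degree.
rewrite (bigID [pred i | d i == 1%N]) /=; congr (_ + _)%N.
  by apply: eq_bigr => i /eqP.
by apply: eq_bigr => i; have := d12 i; lia.
Qed.

Lemma num_deg1_le : (num_deg d 1 <= n)%N.
Proof. by rewrite -[leqRHS](card_ord n) max_card. Qed.

Lemma card_moved_sibling : #|moved_set sibling| = (2 * (n - num_deg d 1))%N.
Proof. by rewrite card_fixedC card_fixed_sibling card_half_edge total_degree_eq addKn. Qed.

Section Components.
Variable M : perfect_matching d.

Local Notation conn := (hconn sibling (mate M)).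
Local Notation vcomp := (vcomp sibling (fun h : H => tag h) (mate M)).

(** An edge of a vertex path is a [mate] step, preceded by a [sibling] step if it starts at the
    other half-edge; conversely a [sibling] step does not change the vertex. *)
Lemma connect_adjacentP h w :
  reflect (exists2 z, conn h z & tag z = w) (connect (Defs.adjacent M) (tag h) w).
Proof.
apply: (iffP idP) => [/connectP[p + ->]|[z /connectP[p + ->] <-]].
  suff gen u z : tag z = u -> conn h z -> path (Defs.adjacent M) u p ->
      exists2 y, conn h y & tag y = last u p by apply: gen => //; apply: hconn_refl.
  elim: p u z => [|v p IH] u z /= zu hz; first by exists z.
  case/andP=> /existsP[a /existsP[b /and3P[+ /eqP au /eqP bv]]] vp.
  rewrite edgeE => /eqP bE.
  apply: (IH _ b) => //.
  have ha : conn h a.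
    have /eq_tag_sibling/orP[/eqP->//|/eqP->] : tag z = tag a by rewrite zu au.
    exact: hconn_trans hz (hconn_s _ _ _).
  by rewrite bE; apply: hconn_trans ha (hconn_g _ _ _).
elim: p h => //= a p IH h /andP[/orP[/eqP->|/eqP aE] /IH]; first by [].
apply: connect_trans; apply: connect1; apply/existsP; exists h; apply/existsP; exists a.
by rewrite edgeE aE !eqxx.
Qed.

Lemma componentsE : components M = [set vcomp h | h in [set: H]]%SET.
Proof.
have blockE h : [set y in [set: 'I_n] | connect (Defs.adjacent M) (tag h) y]%SET = vcomp h.
  apply/finset.setP => w; rewrite !inE /=; apply/connect_adjacentP/imsetP.
    by case=> z hz zw; exists z; rewrite ?inE.
  by case=> z; rewrite inE => hz ->; exists z.
apply/finset.setP => C; apply/imsetP/imsetP => -[x _ ->].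
  by have [h <-] := half_edge_at x; exists h.
by exists (tag x).
Qed.

Lemma sorted_component_sizes : sorted geq (component_sizes M).
Proof. by apply: sort_sorted => x y; apply: leq_total. Qed.

Lemma largest_component_size_vcomp j t : (0 < t <= largest_component_size j M)%N ->
  exists h, (t <= #|vcomp h|)%N.
Proof.
case/andP=> t0; rewrite /largest_component_size => tj.
(* The default 0 of [nth] is ruled out by [0 < t]. *)
have [jlt|jge] := ltnP j.-1 (size (component_sizes M)); last first.
  by rewrite nth_default // in tj; lia.
have := mem_nth 0%N jlt; rewrite mem_sort => /mapP[C].
rewrite mem_enum componentsE => /imsetP[h _ ->] E.
by exists h; rewrite E in tj.
Qed.

(** If entry [j] of the nonincreasing list were below [t], all later entries would be too, which
    leaves room for only [j - 1] components of size at least [t]. *)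
Lemma largest_component_size_ge j t (S : {set {set 'I_n}}) : (0 < j)%N ->
  S \subset components M -> (forall C : {set 'I_n}, C \in S -> (t <= #|C|)%N) ->
  (j <= #|S|)%N -> (t <= largest_component_size j M)%N.
Proof.
move=> j0 SM St jS; rewrite leqNgt; apply/negP => lt.
have : (j <= count (fun m => t <= m)%N (component_sizes M))%N.
  apply: leq_trans jS _; rewrite /component_sizes count_sort count_map.
  rewrite cardE -size_filter; apply: uniq_leq_size; first exact: enum_uniq.
  move=> C; rewrite mem_enum mem_filter mem_enum => CS.
  by rewrite /= (fintype.subsetP SM) // St.
rewrite -(cat_take_drop j.-1 (component_sizes M)) count_cat.
rewrite [X in (_ + X)%N](_ : _ = 0)%N.
  by have := count_size (fun m => t <= m)%N (take j.-1 (component_sizes M));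
     rewrite size_take_min; lia.
apply/eqP; rewrite -leqn0 leqNgt -has_count; apply/hasPn => m.
move=> /(nthP 0%N)[i]; rewrite size_drop nth_drop ltn_subRL => ilt <-; rewrite -ltnNge.
apply: leq_ltn_trans lt; rewrite /largest_component_size.
have gt : transitive geq by move=> x y z /= yx zy; apply: leq_trans zy yx.
have gr : reflexive geq by move=> x /=.
apply: (sorted_leq_nth gt gr 0%N sorted_component_sizes); rewrite ?inE ?leq_addr //.
by apply: leq_ltn_trans ilt; apply: leq_addr.
Qed.

End Components.
End DegreeOneTwo.

Section UniformProbability.
Variables (R : realType) (T : finType).
Local Open Scope ring_scope.
Implicit Types E : pred T.

Lemma uniform_prob_of_le E (x : R) :
  0 <= x -> #|E|%:R <= x * #|T|%:R -> uniform_prob_of R E <= x.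
Proof.
move=> x0; rewrite /uniform_prob_of; have [->|T0] := posnP #|T|.
  by rewrite mulr0n invr0 !mulr0.
by rewrite ler_pdivrMr // ltr0n.
Qed.

Lemma uniform_prob_of_sub E E1 :
  (forall w, E w -> E1 w) -> uniform_prob_of R E <= uniform_prob_of R E1.
Proof.
move=> EE; rewrite /uniform_prob_of ler_wpM2r ?invr_ge0 // ler_nat.
by apply: subset_leq_card; apply/fintype.subsetP => w; rewrite !unfold_in => /EE.
Qed.

Lemma uniform_prob_of_subU E E1 E2 :
  (forall w, E w -> E1 w || E2 w) ->
  uniform_prob_of R E <= uniform_prob_of R E1 + uniform_prob_of R E2.
Proof.
move=> EE; rewrite /uniform_prob_of -mulrDl ler_wpM2r ?invr_ge0 // -natrD ler_nat.
rewrite -cardUI; apply: leq_trans (leq_addr _ _); apply: subset_leq_card.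
by apply/fintype.subsetP => w; rewrite !unfold_in => /EE.
Qed.

End UniformProbability.

(** * Tail bounds for a fixed degree sequence *)

Section FiniteBounds.
Variables (R : realType) (n : nat) (d : 'I_n -> nat).
Hypothesis d12 : forall i, (0 < d i <= 2)%N.
Local Notation H := (half_edge d).
Local Notation n1 := (num_deg d 1).
Local Open Scope ring_scope.

Local Notation p K := (survival_prob R (sibling (d := d)) K).

Let card_matchings : #|{: perfect_matching d}| =
  num_ext (Nil (H * H)) (predT : pred {ffun H -> H}).
Proof. by rewrite -card_perfect_matching; apply: eq_card. Qed.

Lemma prob_large j K : (0 < n1)%N -> (4 * K <= 2 * (n - n1))%N ->
  uniform_prob_of R [pred M : perfect_matching d | (K.+1 < largest_component_size j M)%N]
    <= n1%:R * p K + (2 * (n - n1))%:R * p K / K.+2%:R.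
Proof.
move=> n1_gt0 Kn; have p0 := survival_prob_ge0 R (sibling (d := d)) K.
have sK := siblingK (d := d).
rewrite -(card_moved_sibling d12) -(card_fixed_sibling d12).
apply: uniform_prob_of_le; first by rewrite addr_ge0 ?mulr_ge0.
rewrite card_matchings.
have := @num_large_vcomp R H 'I_n _ (fun h => tag h) sK (fun=> erefl) K.
rewrite card_fixed_sibling // card_moved_sibling // => /(_ n1_gt0 Kn); apply: le_trans.
rewrite -card_perfect_matching ler_nat; apply: subset_leq_card.
apply/fintype.subsetP => M; rewrite !inE => Mj.
have [|h hK] := @largest_component_size_vcomp _ _ d12 M j K.+2; first by rewrite ltn0Sn.
by apply/existsP; exists h.
Qed.

(** [2 * j] surviving leaves lie in at least [j] components, and [num_few_survivors] wants this
    number to be at most half the mean; hence [4 * j]. *)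
Lemma prob_small j K : (0 < j)%N -> (0 < n1)%N -> (4 * K <= 2 * (n - n1))%N ->
  (4 * j)%:R <= n1%:R * p K ->
  uniform_prob_of R [pred M : perfect_matching d | (largest_component_size j M <= K)%N]
    <= 8 / (n1%:R * p K).
Proof.
move=> j0 n1_gt0 Kn jp; have p0 := survival_prob_ge0 R (sibling (d := d)) K.
have sK := siblingK (d := d).
apply: uniform_prob_of_le; first by rewrite divr_ge0 ?mulr_ge0.
have np_gt0 : 0 < n1%:R * p K by apply: lt_le_trans jp; rewrite ltr0n muln_gt0.
have jp' : (2 * (2 * j))%:R <= n1%:R * p K by rewrite mulnA.
rewrite card_matchings.
have := @num_few_survivors R H _ sK K _ _ (2 * j)%N.
rewrite card_fixed_sibling // card_moved_sibling // => /(_ n1_gt0 Kn np_gt0 jp').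
apply: le_trans; rewrite -card_perfect_matching ler_nat; apply: subset_leq_card.
apply/fintype.subsetP => M; rewrite !inE leqNgt => /negP Mj; rewrite ltnNge; apply/negP => jZ.
have := num_survivors_vcomp sK (tg := fun h : H => tag h) (eq_tag_sibling d12) K (mate_matching M).
pose S := [set vcomp (sibling (d := d)) (fun h : H => tag h) (mate M) h | h in
  [set h in fixed_set (sibling (d := d)) | survives (sibling (d := d)) K h (mate M)]]%SET.
rewrite -/S => ZS; apply: Mj.
apply: (largest_component_size_ge (S := S) j0); last 1 first.
- have := leq_trans jZ ZS; rewrite leq_mul2l /=; apply.
- apply/fintype.subsetP => C /imsetP[h _ ->]; rewrite (componentsE d12).
  by apply: imset_f.
move=> C /imsetP[h]; rewrite inE => /andP[hF hs] ->.
apply: (survives_vcomp sK (tg := fun h : H => tag h) (fun=> erefl)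
  (eq_tag_sibling d12) (mate_matching M) hF hs).
Qed.

End FiniteBounds.

(** * Estimates *)

Section SurvivalEstimates.
Variable R : realType.
Local Open Scope ring_scope.

Lemma falling2_divE (a m K : nat) : (2 * K <= a)%N ->
  (falling2 a K)%:R / (falling2 (a + m) K)%:R =
  \prod_(i < K) ((a - i.*2)%:R / ((a - i.*2)%:R + m%:R)) :> R.
Proof.
move=> Ka; rewrite prodf_div /falling2 !natr_prod; congr (_ / _).
apply: eq_bigr => i _; have := ltn_ord i; rewrite -natrD => iK; congr _%:R; lia.
Qed.

(** Each factor is [x / (x + m) = 1 - m / (x + m)] with [x <= a], hence at most
    [expR (- (m / (a + m)))]. *)
Lemma falling2_div_le (a m K : nat) : (2 * K <= a)%N ->
  (falling2 a K)%:R / (falling2 (a + m) K)%:R <= expR (- (K%:R * (m%:R / (a + m)%:R))) :> R.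
Proof.
move=> Ka; rewrite falling2_divE // -mulrN expRM_natl -[X in _ ^+ X]card_ord -prodr_const.
apply: ler_prod => i _; have iK := ltn_ord i.
have x0 : 0 < (a - i.*2)%:R :> R by rewrite ltr0n; lia.
have m0 : 0 <= m%:R :> R by [].
have xa : (a - i.*2)%:R <= a%:R :> R by rewrite ler_nat leq_subr.
move: (a - i.*2)%:R x0 xa => x x0 xa.
apply/andP; split; first by apply: divr_ge0; lra.
apply: le_trans (expR_ge1Dx _).
have -> : x / (x + m%:R) = 1 - m%:R / (x + m%:R) by field; lra.
rewrite natrD lerD2l lerN2 ler_wpM2l // lef_pV2 ?posrE ?lerD2r //; lra.
Qed.

(** The inverse of each factor is [1 + m / x <= expR (m / x)], and [x >= a - 2 * K]. *)
Lemma falling2_div_ge (a m K : nat) : (2 * K < a)%N ->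
  expR (- (K%:R * (m%:R / (a - K.*2)%:R))) <= (falling2 a K)%:R / (falling2 (a + m) K)%:R :> R.
Proof.
move=> Ka; rewrite falling2_divE 1?ltnW // -mulrN expRM_natl -[X in _ ^+ X]card_ord -prodr_const.
apply: ler_prod => i _; have iK := ltn_ord i; rewrite expR_ge0 /=.
have y0 : 0 < (a - K.*2)%:R :> R by rewrite ltr0n; lia.
have m0 : 0 <= m%:R :> R by [].
have yx : (a - K.*2)%:R <= (a - i.*2)%:R :> R by rewrite ler_nat; lia.
move: (a - i.*2)%:R (a - K.*2)%:R y0 yx => x y y0 yx.
have x0 : 0 < x by lra.
rewrite expRN -[leRHS]invrK lef_pV2 ?posrE ?expR_gt0 ?invr_gt0 ?divr_gt0 ?ltr_wpDr //.
rewrite invf_div; apply: le_trans (expR_ge1Dx _).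
have -> : (x + m%:R) / x = 1 + m%:R / x by field; lra.
by rewrite lerD2l ler_wpM2l // lef_pV2 ?posrE.
Qed.

(** Squaring [u <= expR u] at [u = ln x / 2] gives [(ln x) ^ 2 <= 4 * x]. *)
Lemma ln_div_le (x : R) : 1 < x -> ln x / x <= 4 / ln x.
Proof.
move=> x1; have x0 : 0 < x by lra.
have l0 : 0 < ln x by rewrite ln_gt0.
have h := expR_ge1Dx (ln x / 2).
have xE : x = expR (ln x / 2) ^+ 2.
  by rewrite -expRM_natl (_ : 2%:R * (ln x / 2) = ln x) ?lnK //; field.
rewrite ler_pdivrMr // mulrAC ler_pdivlMr // [in leRHS]xE.
have : (ln x / 2) ^+ 2 <= expR (ln x / 2) ^+ 2 by rewrite lerXn2r ?nnegrE; lra.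
by move: (expR _ ^+ 2) => z; lra.
Qed.

Section Bound.
Variables (n : nat) (d : 'I_n -> nat).
Hypothesis d12 : forall i, (0 < d i <= 2)%N.
Local Notation m := (num_deg d 1).
Local Notation p K := (survival_prob R (sibling (d := d)) K).

Lemma survival_prob_le K : (0 < m < n)%N -> (2 * K <= 2 * (n - m))%N ->
  p K <= expR (- (K%:R * ((m%:R - 1) / (2 * n%:R)))).
Proof.
case/andP=> m0 mn Kn; rewrite /survival_prob.
rewrite card_moved_sibling // card_half_edge total_degree_eq //.
have -> : (m + 2 * (n - m) - 1 = 2 * (n - m) + (m - 1))%N by lia.
apply: le_trans (falling2_div_le _ Kn) _; rewrite ler_expR lerN2 ler_wpM2l //.
rewrite -(natrB R m0) ler_wpM2l // -natrM lef_pV2 ?posrE ?ltr0n ?ler_nat; lia.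
Qed.

Lemma survival_prob_ge K : (0 < m)%N -> (2 * K < 2 * (n - m))%N ->
  expR (- (K%:R * (m%:R / (2 * (n%:R - m%:R - K%:R))))) <= p K.
Proof.
move=> m0 Kn; have mn := num_deg1_le d; rewrite /survival_prob.
rewrite card_moved_sibling // card_half_edge total_degree_eq //.
have -> : (m + 2 * (n - m) - 1 = 2 * (n - m) + (m - 1))%N by lia.
apply: le_trans (falling2_div_ge _ Kn); rewrite ler_expR lerN2 ler_wpM2l //.
have -> : 2 * (n%:R - m%:R - K%:R) = (2 * (n - m) - K.*2)%:R :> R.
  rewrite -natrB // -natrB; last by lia.
  by rewrite -natrM; congr _%:R; lia.
by rewrite ler_wpM2r ?invr_ge0 // ler_nat leq_subr.
Qed.

End Bound.
End SurvivalEstimates.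

(** * Deviations from 2 n log n_1 / n_1 *)

Section Deviation.
Variable R : realType.
Local Open Scope ring_scope.

(** [N], [x], [q], [k] stand for n, n_1, log n_1 / n_1 and the number of steps, so [q * x] is log
    n_1. The loss of 2 covers [(1 + e) * q <= 1] and [(x - 1) / N <= 1]. *)
Lemma upper_exponent (N x q e k : R) : 0 < e <= 1 / 2 -> 0 < N -> 1 < x ->
  x <= e / 4 * N -> 0 < q <= e / 32 -> (1 + e) * (2 * N * q) - 2 <= k ->
  (1 + e) * (q * x) - 2 <= k * ((x - 1) / (2 * N)).
Proof.
move=> /andP[e0 e1] N0 x1 xN /andP[q0 q1] kq.
have xN' : (x - 1) / N <= 1 by rewrite ler_pdivrMr // mul1r; nra.
have w0 : 0 <= (x - 1) / (2 * N) by apply: divr_ge0; lra.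
apply: le_trans (ler_wpM2r w0 kq).
have -> : ((1 + e) * (2 * N * q) - 2) * ((x - 1) / (2 * N)) =
    (1 + e) * (q * x) - (1 + e) * q - (x - 1) / N by field; lra.
have : (1 + e) * q <= 1 by nra.
lra.
Qed.

(** As [x + k <= e / 2 * N], the denominator is at least [2 * (1 - e / 2) * N]; then
    [1 - e <= (1 - e / 2) ^ 2] gives the claim. *)
Lemma lower_exponent (N x q e k : R) : 0 < e <= 1 / 2 -> 0 < N -> 0 < x ->
  x <= e / 4 * N -> 0 < q <= e / 32 -> k <= (1 - e) * (2 * N * q) ->
  k * (x / (2 * (N - x - k))) <= (1 - e / 2) * (q * x).
Proof.
move=> /andP[e0 e1] N0 x0 xN /andP[q0 q1] kq.
have Nq : N * q <= N * (e / 32) by rewrite ler_pM2l.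
have kN : k <= e / 16 * N by nra.
have D : (1 - e / 2) * N <= N - x - k by nra.
have D0 : 0 < N - x - k by nra.
rewrite mulrA ler_pdivrMr ?mulr_gt0 //.
have : k * x <= (1 - e) * (2 * N * q) * x by rewrite ler_pM2r.
have qx : 0 <= (1 - e / 2) * (q * x) * 2 by rewrite !mulr_ge0 //; lra.
have := ler_wpM2l qx D; have : 0 <= N * q * x * e ^+ 2 by rewrite !mulr_ge0 ?sqr_ge0 ?ltW.
set y := N - x - k; nra.
Qed.

Lemma double_lt_of_quadruple_le (k x : nat) :
  (0 < x)%N -> (4 * k <= 2 * x)%N -> (2 * k < 2 * x)%N.
Proof. lia. Qed.

Section Degrees.
Variables (n : nat) (d : 'I_n -> nat).
Hypothesis d12 : forall i, (0 < d i <= 2)%N.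
Local Notation m := (num_deg d 1).
Local Notation p K := (survival_prob R (sibling (d := d)) K).
Local Notation L := (ln (m%:R : R)).
Local Notation A := (2 * n%:R * L / m%:R).
Variables (j : nat) (e : R).
Hypotheses (j_gt0 : (0 < j)%N) (e0 : 0 < e) (e1 : e <= 1 / 2).
Hypotheses (mn : m%:R <= e / 4 * n%:R) (eL : 128 / e <= L).

Let e12 : 0 < e <= 1 / 2. Proof. by rewrite e0 e1. Qed.

Let L_gt : 1 < L.
Proof. by apply: lt_le_trans eL; rewrite ltr_pdivlMr //; have := e1; lra. Qed.

Let m_gt1 : 1 < m%:R :> R.
Proof. by rewrite ltNge; apply/negP => /(@ln_le0 R); have := L_gt; lra. Qed.

Let m_gt0 : (0 < m)%N.
Proof. by rewrite -(ltr0n R); have := m_gt1; lra. Qed.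

Let n_gt0 : 0 < n%:R :> R.
Proof. by have := mn; have := m_gt1; have := e0; nra. Qed.

Let q := L / m%:R.

Let q12 : 0 < q <= e / 32.
Proof.
apply/andP; split; first by apply: divr_gt0; [have := L_gt|have := m_gt1]; lra.
(* [4 / L <= e / 32] is the origin of the bound [128 / e] on [L]. *)
apply: le_trans (ln_div_le m_gt1) _; rewrite ler_pdivrMr; last by have := L_gt; lra.
by move: eL; rewrite ler_pdivrMr //; lra.
Qed.

Let qm : q * m%:R = L.
Proof. by rewrite /q divfK // gt_eqF // (lt_trans ltr01). Qed.

Let AE : A = 2 * n%:R * q.
Proof. by rewrite /q mulrA. Qed.

Let A_gt1 : 1 < A.
Proof.
have : 1 < q * n%:R.
  have := qm; have := L_gt; have := mn; case/andP: q12 => q0 _.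
  have := n_gt0; have := e0; have := e1; nra.
by rewrite AE; lra.
Qed.

Let room K : K%:R <= 2 * A -> (4 * K <= 2 * (n - m))%N.
Proof.
move=> KA; rewrite -(ler_nat R) !natrM natrB ?num_deg1_le //.
move: KA; rewrite AE; case/andP: q12 => q0 q1 KA.
have : n%:R * q <= n%:R * (e / 32) by rewrite ler_pM2l.
have := n_gt0; have := mn; have := e0; have := e1; nra.
Qed.

Let mn' : (m < n)%N.
Proof. by rewrite -(ltr_nat R); have := mn; have := n_gt0; have := e0; have := e1; nra. Qed.

Let strict_room K : (4 * K <= 2 * (n - m))%N -> (2 * K < 2 * (n - m))%N.
Proof. by apply: double_lt_of_quadruple_le; rewrite subn_gt0 mn'. Qed.

Let mE : expR L = m%:R.
Proof. by rewrite lnK // posrE (lt_trans ltr01). Qed.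

Lemma prob_upper_tail :
  uniform_prob_of R [pred M : perfect_matching d |
      (1 + e) * A < (largest_component_size j M)%:R]
    <= 2 * expR (2 - e * L).
Proof.
have A1 := A_gt1; have m1 := m_gt1; have [e0' e1'] := (e0, e1).
have A0 : 0 <= (1 + e) * A by apply: mulr_ge0; lra.
have := truncn_itv A0; set t := Num.truncn _ => /andP[tA At].
have t0 : (0 < t)%N by rewrite truncn_gt0; nra.
(* [prob_large] is applied with [K = t - 1], since it concerns sizes above [K + 1 = t]; thus
   [K >= (1 + e) * A - 2]. *)
have tE : t = t.-1.+1 by rewrite prednK.
have tR : t.-1%:R = t%:R - 1 :> R by rewrite [in RHS]tE -natr1 addrK.
have tS : t.+1%:R = t%:R + 1 :> R by rewrite natr1.
have K1 : (4 * t.-1 <= 2 * (n - m))%N by apply: room; rewrite tR; nra.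
have p0 := survival_prob_ge0 R (sibling (d := d)) t.-1.
apply: le_trans (_ : m%:R * p t.-1 + (2 * (n - m))%:R * p t.-1 / t.-1.+2%:R <= _).
  apply: le_trans (prob_large R d12 j m_gt0 K1).
  apply: uniform_prob_of_sub => M /= ML.
  by rewrite -tE -(ltr_nat R); apply: le_lt_trans tA ML.
have mp : m%:R * p t.-1 <= expR (2 - e * L).
  apply: le_trans (_ : m%:R * expR (- (t.-1%:R * ((m%:R - 1) / (2 * n%:R)))) <= _).
    apply: ler_wpM2l => //; apply: (survival_prob_le R d12); first by rewrite m_gt0 mn'.
    by apply: leq_trans K1; rewrite leq_mul2r orbT.
  rewrite -[X in X * expR _]mE.
  rewrite -expRD ler_expR.
  have : (1 + e) * (2 * n%:R * q) - 2 <= t.-1%:R by rewrite -AE tR; lra.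
  by move/(upper_exponent e12 n_gt0 m_gt1 mn q12); rewrite qm; lra.
(* The cycle term is at most the leaf term: [m * (t + 1) > m * A = 2 * n * L] and [L > 1]. *)
have : (2 * (n - m))%:R * p t.-1 / t.-1.+2%:R <= m%:R * p t.-1.
  rewrite ler_pdivrMr // mulrAC ler_wpM2r // -tE.
  have : (2 * (n - m))%:R <= 2 * n%:R :> R by rewrite -natrM ler_nat leq_mul2l leq_subr orbT.
  have : A < t.+1%:R by nra.
  rewrite AE => /ltW/(ler_wpM2l (ltW (lt_trans ltr01 m_gt1))).
  have := qm; have := L_gt; have := n_gt0.
  set u := t.+1%:R; set v := _%:R => ? ? ?; nra.
by move=> h; rewrite [leRHS]mulr_natl mulr2n lerD // (le_trans h mp).
Qed.

Lemma prob_lower_tail : (4 * j)%:R <= expR (e * L / 2) ->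
  uniform_prob_of R [pred M : perfect_matching d |
      (largest_component_size j M)%:R < (1 - e) * A]
    <= 8 * expR (- (e * L / 2)).
Proof.
move=> jL.
have A1 := A_gt1; have m1 := m_gt1; have [e0' e1'] := (e0, e1).
have A0 : 0 <= (1 - e) * A by apply: mulr_ge0; lra.
have := truncn_itv A0; set t := Num.truncn _ => /andP[tA At].
have K1 : (4 * t <= 2 * (n - m))%N by apply: room; nra.
have K2 := strict_room K1.
have mp : expR (e * L / 2) <= m%:R * p t.
  apply: le_trans (_ : m%:R * expR (- (t%:R * (m%:R / (2 * (n%:R - m%:R - t%:R))))) <= _).
    rewrite -[X in X * expR _]mE.
    rewrite -expRD ler_expR; rewrite AE in tA.
    have := lower_exponent e12 n_gt0 (lt_trans ltr01 m_gt1) mn q12 tA.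
    by rewrite qm; lra.
  by apply: ler_wpM2l => //; apply: (survival_prob_ge R d12 m_gt0 K2).
rewrite expRN; apply: le_trans (_ : 8 / (m%:R * p t) <= _); last first.
  rewrite ler_wpM2l // lef_pV2 ?posrE ?expR_gt0 //.
  by apply: lt_le_trans mp; rewrite expR_gt0.
apply: le_trans (prob_small d12 j_gt0 m_gt0 K1 (le_trans jL mp)).
apply: uniform_prob_of_sub => M /= ML.
by rewrite -ltnS -(ltr_nat R); apply: lt_trans ML At.
Qed.

Lemma prob_deviation : (4 * j)%:R <= expR (e * L / 2) ->
  uniform_prob_of R [pred M : perfect_matching d |
      e < `|(largest_component_size j M)%:R / A - 1|]
    <= 2 * expR (2 - e * L) + 8 * expR (- (e * L / 2)).
Proof.
move=> jL; apply: le_trans (lerD prob_upper_tail (prob_lower_tail jL)).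
have A0 : 0 < A := lt_trans ltr01 A_gt1.
apply: uniform_prob_of_subU => M /=; rewrite ltr_normr => /orP[] h; apply/orP.
  by left; rewrite -ltr_pdivlMr // -ltrBrDl.
by right; rewrite -ltr_pdivrMr // ltrBrDr addrC -ltrBrDr -opprB.
Qed.

End Degrees.
End Deviation.

(** * The asymptotic statement *)

Lemma degree_one_two (n : nat) (d : 'I_n -> nat) :
  num_deg d 0 = 0%N -> total_degree_neq2 d = num_deg d 1 -> forall i, (0 < d i <= 2)%N.
Proof.
move=> d0 d2 i; apply/andP; split.
  rewrite lt0n; apply/negP => di; have /card0_eq/(_ i) := d0.
  by rewrite inE di.
rewrite leqNgt; apply/negP => di.
have le_max : (d i <= \max_(i < n) d i)%N by apply: leq_bigmax.
have i1 : (1 < (\max_(i < n) d i).+1)%N by lia.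
have ik : (d i < (\max_(i < n) d i).+1)%N by [].
(* The terms of degree 1 and of degree [d i] are isolated: the first is already n_1, and the second
   is positive. *)
move: d2; rewrite /total_degree_neq2 (bigD1 (Ordinal i1)) //= (bigD1 (Ordinal ik)) /=; last first.
  by rewrite -val_eqE /=; lia.
have : (0 < num_deg d (d i))%N by apply/card_gt0P; exists i; rewrite inE.
rewrite mul1n; nia.
Qed.

Unset Implicit Arguments.
Local Open Scope ring_scope.
Local Open Scope classical_set_scope.

(** The identity is asked only for large n because its normalising factor is 0 when n_1 = 1. *)
Theorem theorem2p4 (R : realType) (d : forall n : nat, 'I_n -> nat)
  (d_even : forall n, ~~ odd (total_degree (d n)))
  (d_no0 : forall n, num_deg (d n) 0 = 0%N)
  (d_neq2 : forall n, total_degree_neq2 (d n) = num_deg (d n) 1)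
  (d_mean : (total_degree (d n))%:R / n%:R @[n --> \oo] --> (2 : R))
  (d_n1 : num_deg (d n) 1 @[n --> \oo] --> \oo)
  (j : nat) (j_ge1 : (1 <= j)%N) :
  exists X : forall n, perfect_matching (d n) -> R,
    little_o_P1 X /\
    \forall n \near \oo, forall M : perfect_matching (d n),
      (largest_component_size j M)%:R =
      2 * n%:R * ln (num_deg (d n) 1)%:R / (num_deg (d n) 1)%:R
        * (1 + X n M).
Proof.
have d12 n := degree_one_two (d_no0 n) (d_neq2 n).
pose L n : R := ln (num_deg (d n) 1)%:R.
have lnL (B : R) : \forall n \near \oo, B <= L n.
  move/cvgnyPge: d_n1 => /(_ (Num.truncn (expR B)).+1); apply: filterS => n mB.
  rewrite /L -[leLHS]expRK; rewrite ler_ln ?posrE ?expR_gt0 ?ltr0n //; last first.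
    exact: leq_trans mB.
  apply: le_trans (ltW (truncnS_gt _)) _; by rewrite ler_nat.
pose A n : R := 2 * n%:R * ln (num_deg (d n) 1)%:R / (num_deg (d n) 1)%:R.
exists (fun n M => (largest_component_size j M)%:R / A n - 1); split; last first.
  near=> n => M; rewrite -/(A n) addrC subrK mulrC divfK //.
  have L1 : 1 <= L n by near: n; exact: lnL.
  have m0 : (0 < num_deg (d n) 1)%N.
    by rewrite lt0n; apply: contraTneq L1 => m0; rewrite /L m0 ln0 //; lra.
  have n0 := leq_trans m0 (num_deg1_le (d n)).
  by rewrite gt_eqF // divr_gt0 ?ltr0n // !mulr_gt0 ?ltr0n // (lt_le_trans ltr01 L1).
(* The tail bounds need [e <= 1 / 2]; shrinking [eps] only enlarges the event. *)
move=> eps eps0; pose e := Num.min eps (1 / 2).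
have e0 : 0 < e by rewrite lt_min eps0; lra.
have e1 : e <= 1 / 2 by rewrite ge_min lexx orbT.
have ee : e <= eps by rewrite ge_min lexx.
(* With [y = expR (e * L n / 2) > 1], the bound of [prob_deviation] is
   [2 * expR 2 / y ^ 2 + 8 / y <= C / y]. *)
pose C : R := 2 * expR 2 + 8.
have C0 : 0 < C by have := expR_gt0 (2 : R); rewrite /C; lra.
apply/cvgrPdist_lt => del del0; near=> n.
set P := uniform_prob_of _ _; have P0 : 0 <= P by rewrite divr_ge0.
rewrite sub0r normrN ger0_norm //.
(* [L1] is the hypothesis of the tail bounds; [L2] and [L3] give [4 * j <= y] and [C / y < del]
   through [1 + e * L n / 2 <= y]. *)
have L1 : 128 / e <= L n by near: n; exact: lnL.
have L2 : 8 * j%:R / e <= L n by near: n; exact: lnL.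
have L3 : 2 * C / (del * e) <= L n by near: n; exact: lnL.
have n_gt0 : (0 < n)%N by near: n; exact: nbhs_infty_gt.
(* Since the total degree is 2 n - n_1, [d_mean] says that n_1 / n tends to 0. *)
have mn : (num_deg (d n) 1)%:R <= e / 4 * n%:R :> R.
  have : `|2 - (total_degree (d n))%:R / n%:R| < e / 4 :> R.
    near: n; move/cvgrPdist_lt: d_mean; apply; lra.
  have -> : 2 - (total_degree (d n))%:R / n%:R = (num_deg (d n) 1)%:R / n%:R :> R.
    have n0 : n%:R != 0 :> R by rewrite pnatr_eq0 -lt0n.
    rewrite (total_degree_eq (d12 n)) natrD natrM natrB ?num_deg1_le //.
    by field.
  by rewrite ger0_norm // ltr_pdivrMr ?ltr0n // => /ltW.
pose y := expR (e * L n / 2).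
have yL : 1 + e * L n / 2 <= y := expR_ge1Dx _.
have L0 : 0 < L n by apply: lt_le_trans L1; rewrite divr_gt0.
have eL0 : 0 < e * L n by rewrite mulr_gt0.
have y1 : 1 < y by apply: lt_le_trans yL; lra.
have jy : (4 * j)%:R <= y.
  by move: L2; rewrite ler_pdivrMr // natrM; lra.
have Cy : C / y < del.
  rewrite ltr_pdivrMr; last by lra.
  move: L3; rewrite ler_pdivrMr ?mulr_gt0 // => L3.
  apply: lt_le_trans (ler_wpM2l (ltW del0) yL); lra.
apply: le_lt_trans Cy.
apply: le_trans (_ : uniform_prob_of R [pred M : perfect_matching (d n) |
  e < `|(largest_component_size j M)%:R / A n - 1|] <= _).
  by apply: uniform_prob_of_sub => M; apply: le_lt_trans.
apply: le_trans (prob_deviation (d12 n) j_ge1 e0 e1 mn L1 jy) _.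
rewrite -/(L n) -/y ler_pdivlMr; last by lra.
have -> : expR (2 - e * L n) = expR 2 / y / y.
  by rewrite /y -!expRN -!expRD; congr expR; field.
rewrite expRN -/y /C mulrDl mulfVK; last by lra.
have -> : 2 * (expR 2 / y / y) * y = 2 * expR 2 / y by field; lra.
rewrite lerD2r ler_pdivrMr; last by lra.
by rewrite ler_peMr ?mulr_ge0 ?expR_ge0 // ltW.
Unshelve. all: end_near.
Qed.
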